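(* Let $R_c,\kappa_1,\kappa_2>0$ and $c_1,c_2\ge 0$ be constants and let $0<k_{min}<k_{max}$. Then for every $p$ with $0<p<2/R_c$, the convergence factor corresponding to $\tau_{12}=\tau_{21}=p$ satisfies $$|\rho(k,p,p)|=\left|\frac{1-p(R_c+\xi_2(k))}{1+p\,\xi_1(k)}\cdot\frac{1-p(R_c+\xi_1(k))}{1+p\,\xi_2(k)}\right|<1\qquad\text{for all }k\in[k_{min},k_{max}].$$ In other words, for the model problem on $\Omega_1=(-\infty,0)\times\mathbb{R}$, $\Omega_2=(0,\infty)\times\mathbb{R}$, the OSM algorithm with the standard Robin condition converges for every $0<p<2/R_c$, in the sense that for each frequency $k\in[k_{min},k_{max}]$ the Fourier coefficients $A_1^n(k)$, $B_2^n(k)$ of the iteration errors (defined in the context) tend to $0$ as $n\to\infty$.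
   Context: For $i=1,2$ set $\lambda_i(k)=\frac{\sqrt{c_i\kappa_i+\kappa_i^2k^2}}{\kappa_i}$ and $\xi_i(k)=\frac{1}{\kappa_i\lambda_i(k)}=\frac{1}{\sqrt{c_i\kappa_i+\kappa_i^2k^2}}$. The general convergence factor is $$\rho(k,\tau_{12},\tau_{21})=\frac{(1-\tau_{12}R_c)-\tau_{12}\xi_2(k)}{1+\tau_{12}\xi_1(k)}\cdot\frac{(1-\tau_{21}R_c)-\tau_{21}\xi_1(k)}{1+\tau_{21}\xi_2(k)} .$$ Model problem: $-\kappa_i\Delta T_i+c_iT_i=f$ in $\Omega_i$ with interface conditions on $\Gamma=\{0\}\times\mathbb{R}$: $\bm{n}_1\cdot(\kappa_1\nabla T_1)=-\bm{n}_2\cdot(\kappa_2\nabla T_2)$ and $T_1-T_2=R_c\,\bm{n}_2\cdot(\kappa_2\nabla T_2)$, where $\bm{n}_1=(1,0)$, $\bm{n}_2=(-1,0)$, and solutions bounded at infinity. By linearity take $f=0$ (error equations). The OSM with standard Robin condition, after Fourier transform in $x_2$ (frequency $k$), reads for $n\ge 2$ (the first iterates being obtained from arbitrary given interface data in place of the right-hand sides at $x_1=0$): $$(-\kappa_1\partial_{x_1x_1}+c_1+\kappa_1k^2)\hat T_1^n=0\ (x_1<0),\quad(\kappa_1\partial_{x_1}+p)\hat T_1^n=((1-pR_c)\kappa_2\partial_{x_1}+p)\hat T_2^{n-1}\ (x_1=0),$$ $$(-\kappa_2\partial_{x_1x_1}+c_2+\kappa_2k^2)\hat T_2^n=0\ (x_1>0),\quad(-\kappa_2\partial_{x_1}+p)\hat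 T_2^n=((-1+pR_c)\kappa_1\partial_{x_1}+p)\hat T_1^{n-1}\ (x_1=0),$$ with $\hat T_i^n$ bounded at infinity. Hence $\hat T_1^n=A_1^n(k)e^{\lambda_1(k)x_1}$, $\hat T_2^n=B_2^n(k)e^{-\lambda_2(k)x_1}$, and the coefficients obey $A_1^n=\rho(k,p,p)A_1^{n-2}$, $B_2^n=\rho(k,p,p)B_2^{n-2}$. Only frequencies $k\in[k_{min},k_{max}]$ with $0<k_{min}<k_{max}$ (those present in a discretization) are considered. *)

(* Defs.v *)
From Stdlib Require Import Reals.
From Coquelicot Require Import Coquelicot.
Open Scope R_scope.

Definition lambda (kappa c k : R) : R :=
  sqrt (c * kappa + kappa ^ 2 * k ^ 2) / kappa.

Definition xi (kappa c k : R) : R := 1 / (kappa * lambda kappa c k).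

Definition rho (Rc kappa1 kappa2 c1 c2 k tau12 tau21 : R) : R :=
  ((1 - tau12 * Rc) - tau12 * xi kappa2 c2 k) / (1 + tau12 * xi kappa1 c1 k) *
  (((1 - tau21 * Rc) - tau21 * xi kappa1 c1 k) / (1 + tau21 * xi kappa2 c2 k)).

(* Derivative of a complex-valued function of one real variable.  It is total;
   differentiability is [ex_derive] with values in [C_R_NormedModule]. *)
Definition Dx (T : R -> C) (x : R) : C :=
  (Derive (fun y => Re (T y)) x, Derive (fun y => Im (T y)) x).

(* Bounded classical solution, on the half-line D with end F at infinity, of the
   homogeneous equation satisfied by the errors at frequency k. *)
Definition subdomain_solution (D : R -> Prop) (F : (R -> Prop) -> Prop)
    (kappa c k : R) (T : R -> C) : Prop :=
  (forall x, D x ->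
     ex_derive (V := C_R_NormedModule) T x /\
     ex_derive (V := C_R_NormedModule) (Dx T) x /\
     (- RtoC kappa * Dx (Dx T) x + RtoC (c + kappa * k ^ 2) * T x)%C = RtoC 0) /\
  (exists M : R, F (fun x => Cmod (T x) <= M)).

(* a * dT/dx + b * T *)
Definition robin (a b : R) (T : R -> C) (x : R) : C :=
  (RtoC a * Dx T x + RtoC b * T x)%C.

(* The functions are only constrained inside their subdomains, so values on the
   interface x = 0 are one-sided limits. *)
Definition left_trace (u : R -> C) (g : C) : Prop :=
  filterlim u (at_left 0) (locally (T := C_UniformSpace) g).
Definition right_trace (u : R -> C) (g : C) : Prop :=
  filterlim u (at_right 0) (locally (T := C_UniformSpace) g).

(* Iterates are numbered from 1; the terms of index 0 are unconstrained. *)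
Record OSM_Robin (Rc kappa1 kappa2 c1 c2 p k : R) (g1 g2 : C)
    (T1 T2 : nat -> R -> C) : Prop := {
  OSM_solution1 : forall n, (1 <= n)%nat ->
    subdomain_solution (fun x => x < 0) (Rbar_locally m_infty)
      kappa1 c1 k (T1 n);
  OSM_solution2 : forall n, (1 <= n)%nat ->
    subdomain_solution (fun x => 0 < x) (Rbar_locally p_infty)
      kappa2 c2 k (T2 n);
  OSM_init1 : left_trace (robin kappa1 p (T1 1%nat)) g1;
  OSM_init2 : right_trace (robin (- kappa2) p (T2 1%nat)) g2;
  OSM_step1 : forall n, (2 <= n)%nat -> exists g : C,
    left_trace (robin kappa1 p (T1 n)) g /\
    right_trace (robin ((1 - p * Rc) * kappa2) p (T2 (n - 1)%nat)) g;
  OSM_step2 : forall n, (2 <= n)%nat -> exists g : C,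
    right_trace (robin (- kappa2) p (T2 n)) g /\
    left_trace (robin ((-1 + p * Rc) * kappa1) p (T1 (n - 1)%nat)) g
}.

(* Main.v *)
Require Import Defs.
From Stdlib Require Import Reals Lra Lia.
From Coquelicot Require Import Coquelicot.
Open Scope R_scope.

(** At a fixed frequency [k], write [m_i = kappa_i * lambda_i = 1 / xi_i], the
    factor by which [kappa_i * d/dx] multiplies the decaying exponential of the
    subdomain [i], up to sign.

    The bound on [rho] splits: the factor [(1 - p * Rc - p * xi) / (1 + p * xi)]
    has modulus less than one for each [xi > 0] separately.  Its numerator is
    less than its denominator because [p * (Rc + 2 * xi) > 0], and exceeds minus
    the denominator because [p * Rc < 2].  The two factors of [rho], after
    exchanging their denominators, are of this kind
    ([robin_factor_lt_1], [Rabs_rho_lt_1]).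

    For the iteration, a solution of [u'' = lambda ^ 2 * u] on a half-line is a
    combination of [exp (lambda * x)] and [exp (- lambda * x)]
    ([ode_exponentials]), and boundedness at infinity kills the growing one ([bounded_solution],
    [subdomain_solution_exp]), so an iterate is determined by one complex
    coefficient.  On such a function a Robin operator acts as a scalar, hence
    the transmission conditions become
      [(m_1 + p) A_n = (p - (1 - p * Rc) * m_2) B_(n-1)],
      [(m_2 + p) B_n = (p - (1 - p * Rc) * m_1) A_(n-1)].
    Neither of these two steps need be a contraction on its own, but the product
    of their ratios is exactly [rho] ([step_ratio_product]).  Both coefficient
    sequences are therefore multiplied by [rho] every two steps, and tend to
    zero ([two_step_contraction]). *)

(** * The convergence factor *)

Lemma lambda_pos (kappa c k : R) :
  0 < kappa -> 0 <= c -> 0 < k -> 0 < lambda kappa c k.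
Proof.
  intros hka hc hk; unfold lambda.
  apply Rdiv_lt_0_compat; [apply sqrt_lt_R0|exact hka].
  assert (0 < kappa ^ 2) by (apply pow_lt; lra).
  assert (0 < k ^ 2) by (apply pow_lt; lra).
  assert (0 < kappa ^ 2 * k ^ 2) by (apply Rmult_lt_0_compat; lra).
  assert (0 <= c * kappa) by (apply Rmult_le_pos; lra).
  lra.
Qed.

Lemma lambda_sqr (kappa c k : R) :
  0 < kappa -> 0 <= c -> kappa * lambda kappa c k ^ 2 = c + kappa * k ^ 2.
Proof.
  intros hka hc; unfold lambda.
  assert (H : 0 <= c * kappa + kappa ^ 2 * k ^ 2).
  { assert (0 <= c * kappa) by (apply Rmult_le_pos; lra).
    assert (0 <= (kappa * k) ^ 2) by apply pow2_ge_0.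
    rewrite Rpow_mult_distr in *; lra. }
  unfold Rdiv; rewrite Rpow_mult_distr, pow2_sqrt by exact H.
  field; lra.
Qed.

Lemma xi_pos (kappa c k : R) :
  0 < kappa -> 0 <= c -> 0 < k -> 0 < xi kappa c k.
Proof.
  intros hka hc hk; unfold xi.
  apply Rdiv_lt_0_compat; [lra|].
  apply Rmult_lt_0_compat; [exact hka|now apply lambda_pos].
Qed.

(** The two strict inequalities [- (1 + p x) < 1 - p Rc - p x < 1 + p x] are
    [p Rc < 2] and [0 < p (Rc + 2 x)]. *)
Lemma robin_factor_lt_1 (Rc p x : R) :
  0 < Rc -> 0 < p -> p * Rc < 2 -> 0 < x ->
  Rabs ((1 - p * Rc - p * x) / (1 + p * x)) < 1.
Proof.
  intros hR hp h2 hx.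
  assert (0 < p * x) by (apply Rmult_lt_0_compat; lra).
  assert (0 < p * Rc) by (apply Rmult_lt_0_compat; lra).
  rewrite Rabs_div by lra.
  rewrite (Rabs_pos_eq (1 + p * x)) by lra.
  apply Rlt_div_l; [lra|].
  apply Rabs_def1; lra.
Qed.

(** Exchanging the denominators of [rho] gives each numerator the denominator
    with the same [xi]. *)
Lemma Rabs_rho_lt_1 (Rc kappa1 kappa2 c1 c2 k p : R) :
  0 < Rc -> 0 < kappa1 -> 0 < kappa2 -> 0 <= c1 -> 0 <= c2 -> 0 < k ->
  0 < p -> p * Rc < 2 ->
  Rabs (rho Rc kappa1 kappa2 c1 c2 k p p) < 1.
Proof.
  intros hR hk1 hk2 hc1 hc2 hk hp h2; unfold rho.
  pose proof (xi_pos kappa1 c1 k hk1 hc1 hk) as X1.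
  pose proof (xi_pos kappa2 c2 k hk2 hc2 hk) as X2.
  set (x1 := xi kappa1 c1 k) in *; set (x2 := xi kappa2 c2 k) in *.
  assert (0 < p * x1) by (apply Rmult_lt_0_compat; lra).
  assert (0 < p * x2) by (apply Rmult_lt_0_compat; lra).
  replace (_ * _) with
    ((1 - p * Rc - p * x2) / (1 + p * x2) * ((1 - p * Rc - p * x1) / (1 + p * x1)))
    by (field; lra).
  rewrite Rabs_mult; apply Rlt_le_trans with (1 * 1); [|lra].
  apply Rmult_le_0_lt_compat; try apply Rabs_pos; now apply robin_factor_lt_1.
Qed.

(** In terms of [m = 1 / xi], each ratio [(p - (1 - p Rc) m_j) / (m_i + p)] is
    [- xi_i / xi_j] times a factor of [rho]; the prefactors cancel in the
    product. *)
Lemma step_ratio_product (Rc kappa1 kappa2 c1 c2 k p : R) :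
  0 < kappa1 -> 0 < kappa2 -> 0 <= c1 -> 0 <= c2 -> 0 < k -> 0 < p ->
  let m1 := kappa1 * lambda kappa1 c1 k in
  let m2 := kappa2 * lambda kappa2 c2 k in
  (p - (1 - p * Rc) * m2) / (m1 + p) * ((p - (1 - p * Rc) * m1) / (m2 + p)) =
  rho Rc kappa1 kappa2 c1 c2 k p p.
Proof.
  intros hk1 hk2 hc1 hc2 hk hp m1 m2; unfold rho, xi.
  assert (0 < m1) by (apply Rmult_lt_0_compat; [lra|now apply lambda_pos]).
  assert (0 < m2) by (apply Rmult_lt_0_compat; [lra|now apply lambda_pos]).
  fold m1 m2; field; repeat split; lra.
Qed.

(** * Bounded solutions on a half-line *)

Lemma is_derive_zero_constant (D : R -> Prop) (f : R -> R) (x y : R) :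
  (forall a b z, D a -> D b -> a <= z <= b -> D z) ->
  (forall z, D z -> is_derive f z 0) ->
  D x -> D y -> f x = f y.
Proof.
  intros hD hf hx hy.
  assert (hz : forall z, Rmin x y <= z <= Rmax x y -> D z).
  { intros z Hz; destruct (Rle_dec x y) as [h|h].
    - rewrite Rmin_left, Rmax_right in Hz by lra; now apply (hD x y).
    - rewrite Rmin_right, Rmax_left in Hz by lra; now apply (hD y x). }
  destruct (MVT_gen f x y (fun _ => 0)) as [c [_ Hc]].
  - intros z Hz; apply hf, hz; lra.
  - intros z Hz; apply continuity_pt_filterlim.
    apply (ex_derive_continuous (V := R_NormedModule)).
    exists 0; now apply hf, hz.
  - lra.
Qed.

(** Both [(v + s u) exp (- s x)] and [(v - s u) exp (s x)] are first integrals
    of the system [u' = v], [v' = s^2 u]; solving for [u] gives the claim. *)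
Lemma ode_exponentials (D : R -> Prop) (s : R) (u v : R -> R) (x0 : R) :
  (forall a b z, D a -> D b -> a <= z <= b -> D z) -> D x0 -> s <> 0 ->
  (forall x, D x -> is_derive u x (v x)) ->
  (forall x, D x -> is_derive v x (s ^ 2 * u x)) ->
  exists a b : R, forall x, D x -> u x = a * exp (s * x) + b * exp (- s * x).
Proof.
  intros hD h0 hs hu hv.
  pose (f := fun t x => (v x + t * u x) * exp (- t * x)).
  assert (hf : forall t x, t ^ 2 = s ^ 2 -> D x -> f t x = f t x0).
  { intros t x ht hx; apply (is_derive_zero_constant D); auto.
    intros z hz; unfold f.
    pose proof (hu z hz) as U; pose proof (hv z hz) as V.
    auto_derive.
    - repeat split; auto; [exists (s ^ 2 * u z)|exists (v z)]; assumption.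
    - replace (Derive (fun x1 => v x1) z) with (t ^ 2 * u z)
        by (rewrite ht; symmetry; now apply is_derive_unique).
      replace (Derive (fun x1 => u x1) z) with (v z)
        by (symmetry; now apply is_derive_unique).
      ring. }
  exists (f s x0 / (2 * s)), (- f (- s) x0 / (2 * s)); intros x hx.
  rewrite <- (hf s x), <- (hf (- s) x) by (auto; ring).
  unfold f; replace (- - s * x) with (s * x) by ring.
  replace (- s * x) with (- (s * x)) by ring.
  rewrite exp_Ropp; pose proof (exp_pos (s * x)).
  field; lra.
Qed.

(** The sign of [s] is chosen so that [exp (- s x)] is the mode growing along
    [F]; where it exceeds one, the other mode is at most one, so a bound on [u]
    would be a bound on the growing mode if its coefficient were nonzero. *)
Lemma bounded_solution (D : R -> Prop) (F : (R -> Prop) -> Prop)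
    {FF : ProperFilter F} (s M : R) (u v : R -> R) (x0 : R) :
  (forall a b z, D a -> D b -> a <= z <= b -> D z) -> D x0 -> F D -> s <> 0 ->
  filterlim (fun x => exp (- s * x)) F (Rbar_locally p_infty) ->
  (forall x, D x -> is_derive u x (v x)) ->
  (forall x, D x -> is_derive v x (s ^ 2 * u x)) ->
  F (fun x => Rabs (u x) <= M) ->
  exists a : R, forall x, D x -> u x = a * exp (s * x).
Proof.
  intros hD h0 hFD hs hlim hu hv hM.
  destruct (ode_exponentials D s u v x0) as [a [b hab]]; auto.
  exists a; destruct (Req_dec b 0) as [->|hb].
  { intros x hx; rewrite (hab x hx); ring. }
  exfalso.
  pose proof (Rabs_pos_lt b hb) as hb0.
  assert (h1 : F (fun x => 1 < exp (- s * x))) by (apply hlim; now exists 1).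
  assert (h2 : F (fun x => (M + Rabs a) / Rabs b < exp (- s * x)))
    by (apply hlim; now exists ((M + Rabs a) / Rabs b)).
  destruct (filter_ex _ (filter_and _ _ hFD
              (filter_and _ _ hM (filter_and _ _ h1 h2))))
    as [x [hx [hMx [h1x h2x]]]].
  rewrite (hab x hx) in hMx.
  apply Rlt_div_l in h2x; [|exact hb0].
  assert (E : exp (s * x) <= 1).
  { replace (s * x) with (- (- s * x)) by ring; rewrite exp_Ropp.
    rewrite <- Rinv_1; apply Rinv_le_contravar; lra. }
  assert (Ha : Rabs (a * exp (s * x)) <= Rabs a).
  { rewrite Rabs_mult, (Rabs_pos_eq (exp (s * x))) by (left; apply exp_pos).
    rewrite <- (Rmult_1_r (Rabs a)) at 2.
    apply Rmult_le_compat_l; [apply Rabs_pos|exact E]. }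
  assert (Hb : Rabs (b * exp (- s * x)) = exp (- s * x) * Rabs b).
  { rewrite Rabs_mult, (Rabs_pos_eq (exp (- s * x))) by (left; apply exp_pos).
    ring. }
  pose proof (Rabs_triang_inv (b * exp (- s * x)) (- (a * exp (s * x)))) as T.
  rewrite Rabs_Ropp in T.
  replace (b * exp (- s * x) - - (a * exp (s * x)))
    with (a * exp (s * x) + b * exp (- s * x)) in T by ring.
  lra.
Qed.

Lemma ex_derive_Re (T : R -> C) (x : R) :
  ex_derive (V := C_R_NormedModule) T x -> ex_derive (fun y => Re (T y)) x.
Proof.
  intros [l h]; exists (fst l).
  apply (filterdiff_ext_lin _ (fun y : R => fst (scal (V := C_R_NormedModule) y l)));
    [|now intros y].
  apply (filterdiff_comp' (V := C_R_NormedModule) T fst); [exact h|].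
  apply filterdiff_linear, is_linear_fst.
Qed.

Lemma ex_derive_Im (T : R -> C) (x : R) :
  ex_derive (V := C_R_NormedModule) T x -> ex_derive (fun y => Im (T y)) x.
Proof.
  intros [l h]; exists (snd l).
  apply (filterdiff_ext_lin _ (fun y : R => snd (scal (V := C_R_NormedModule) y l)));
    [|now intros y].
  apply (filterdiff_comp' (V := C_R_NormedModule) T snd); [exact h|].
  apply filterdiff_linear, is_linear_snd.
Qed.

Lemma Rabs_Re_le_Cmod (z : C) : Rabs (Re z) <= Cmod z.
Proof. eapply Rle_trans; [apply Rmax_l|apply Rmax_Cmod]. Qed.

Lemma Rabs_Im_le_Cmod (z : C) : Rabs (Im z) <= Cmod z.
Proof. eapply Rle_trans; [apply Rmax_r|apply Rmax_Cmod]. Qed.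

Lemma real_combination_zero (a b : R) (z w : C) :
  (- RtoC a * z + RtoC b * w)%C = RtoC 0 ->
  a * Re z = b * Re w /\ a * Im z = b * Im w.
Proof.
  destruct z as [z1 z2], w as [w1 w2]; intros h.
  pose proof (f_equal Re h) as h1; pose proof (f_equal Im h) as h2.
  cbn in h1, h2 |- *; lra.
Qed.

(** The equation has real coefficients, so real and imaginary parts solve it
    separately. *)
Lemma subdomain_solution_exp (D : R -> Prop) (F : (R -> Prop) -> Prop)
    {FF : ProperFilter F} (kappa c k s : R) (T : R -> C) (x0 : R) :
  (forall a b z, D a -> D b -> a <= z <= b -> D z) -> D x0 -> F D ->
  0 < kappa -> s <> 0 -> kappa * s ^ 2 = c + kappa * k ^ 2 ->
  filterlim (fun x => exp (- s * x)) F (Rbar_locally p_infty) ->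
  subdomain_solution D F kappa c k T ->
  exists A : C, forall x, D x -> T x = (A * RtoC (exp (s * x)))%C.
Proof.
  intros hD h0 hFD hka hs hsq hlim [hode [M hM]].
  destruct (bounded_solution D F s M (fun y => Re (T y))
              (fun y => Re (Defs.Dx T y)) x0)
    as [a ha]; auto.
  - intros x hx; apply Derive_correct, ex_derive_Re, (hode x hx).
  - intros x hx; destruct (hode x hx) as [_ [h2 h3]].
    replace (s ^ 2 * Re (T x)) with (Derive (fun y => Re (Defs.Dx T y)) x).
    + now apply Derive_correct, ex_derive_Re.
    + change (Derive (fun y => Re (Defs.Dx T y)) x) with (Re (Defs.Dx (Defs.Dx T) x)).
      apply real_combination_zero in h3; rewrite <- hsq in h3.
      apply (Rmult_eq_reg_l kappa); lra.
  - generalize hM; apply filter_imp; intros x hx.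
    eapply Rle_trans; [apply Rabs_Re_le_Cmod|exact hx].
  - destruct (bounded_solution D F s M (fun y => Im (T y))
              (fun y => Im (Defs.Dx T y)) x0)
      as [b hb]; auto.
    + intros x hx; apply Derive_correct, ex_derive_Im, (hode x hx).
    + intros x hx; destruct (hode x hx) as [_ [h2 h3]].
      replace (s ^ 2 * Im (T x)) with (Derive (fun y => Im (Defs.Dx T y)) x).
      * now apply Derive_correct, ex_derive_Im.
      * change (Derive (fun y => Im (Defs.Dx T y)) x) with (Im (Defs.Dx (Defs.Dx T) x)).
        apply real_combination_zero in h3; rewrite <- hsq in h3.
        apply (Rmult_eq_reg_l kappa); lra.
    + generalize hM; apply filter_imp; intros x hx.
      eapply Rle_trans; [apply Rabs_Im_le_Cmod|exact hx].
    + exists (a, b); intros x hx.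
      rewrite (surjective_pairing (T x)).
      change (fst (T x)) with (Re (T x)); change (snd (T x)) with (Im (T x)).
      rewrite (ha x hx), (hb x hx).
      unfold Cmult, RtoC; simpl; f_equal; ring.
Qed.

Lemma left_solution_exp (kappa c k : R) (T : R -> C) :
  0 < kappa -> 0 <= c -> 0 < k ->
  subdomain_solution (fun x => x < 0) (Rbar_locally m_infty) kappa c k T ->
  exists A : C, forall x, x < 0 ->
    T x = (A * RtoC (exp (lambda kappa c k * x)))%C.
Proof.
  intros hka hc hk hT; pose proof (lambda_pos kappa c k hka hc hk) as L.
  apply (subdomain_solution_exp (fun x => x < 0) (Rbar_locally m_infty)
           kappa c k (lambda kappa c k) T (-1)); auto; try lra.
  - intros; lra.
  - now exists 0.
  - now apply lambda_sqr.
  - apply filterlim_comp with (Rbar_locally p_infty); [|exact is_lim_exp_p].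
    intros P [B hB]; exists (- B / lambda kappa c k); intros x hx.
    apply hB; apply (Rlt_div_r x) in hx; [|exact L]; lra.
Qed.

Lemma right_solution_exp (kappa c k : R) (T : R -> C) :
  0 < kappa -> 0 <= c -> 0 < k ->
  subdomain_solution (fun x => 0 < x) (Rbar_locally p_infty) kappa c k T ->
  exists B : C, forall x, 0 < x ->
    T x = (B * RtoC (exp (- lambda kappa c k * x)))%C.
Proof.
  intros hka hc hk hT; pose proof (lambda_pos kappa c k hka hc hk) as L.
  apply (subdomain_solution_exp (fun x => 0 < x) (Rbar_locally p_infty)
           kappa c k (- lambda kappa c k) T 1); auto; try lra.
  - intros; lra.
  - now exists 0.
  - rewrite <- (lambda_sqr kappa c k hka hc); ring.
  - apply filterlim_comp with (Rbar_locally p_infty); [|exact is_lim_exp_p].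
    intros P [B hB]; exists (B / lambda kappa c k); intros x hx.
    apply hB; apply (Rlt_div_l B) in hx; [|exact L]; lra.
Qed.

(** * Interface traces *)

(** Only the germ of [T] at a point enters its derivative, so it is enough that
    [T] is exponential on an open set. *)
Lemma robin_exp (D : R -> Prop) (a b s : R) (A : C) (T : R -> C) (x : R) :
  open D -> (forall y, D y -> T y = (A * RtoC (exp (s * y)))%C) -> D x ->
  robin a b T x = (RtoC (a * s + b) * A * RtoC (exp (s * x)))%C.
Proof.
  intros hD hT hx.
  assert (E : Defs.Dx T x = (RtoC s * A * RtoC (exp (s * x)))%C).
  { assert (H : forall (f : R -> R) r, (forall y, D y -> f y = r * exp (s * y)) ->
                Derive f x = s * r * exp (s * x)).
    { intros f r hf; apply is_derive_unique.
      apply (is_derive_ext_loc (fun y => r * exp (s * y))).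
      - generalize (hD x hx); apply filter_imp; intros y hy.
        symmetry; now apply hf.
      - auto_derive; [easy|ring]. }
    unfold Defs.Dx; rewrite (H _ (Re A)), (H _ (Im A)).
    - unfold Cmult, RtoC, Re, Im; simpl; f_equal; ring.
    - intros y hy; rewrite (hT y hy); unfold Im; simpl; ring.
    - intros y hy; rewrite (hT y hy); unfold Re; simpl; ring. }
  unfold robin; rewrite E, (hT x hx).
  rewrite RtoC_plus, RtoC_mult; ring.
Qed.

(** The exponential is one at the interface, so the trace is the coefficient
    times the symbol [a * s + b] of the operator; limits are unique. *)
Lemma robin_trace (D : R -> Prop) (G : (R -> Prop) -> Prop) {FG : ProperFilter G}
    (a b s : R) (A g : C) (T : R -> C) :
  open D -> G D -> filter_le G (locally 0) ->
  (forall y, D y -> T y = (A * RtoC (exp (s * y)))%C) ->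
  filterlim (robin a b T) G (locally (T := C_UniformSpace) g) ->
  g = (RtoC (a * s + b) * A)%C.
Proof.
  intros hD hGD hG hT hg.
  apply (filterlim_locally_unique (V := C_R_NormedModule) (F := G)
           (robin a b T)); [exact hg|].
  apply (filterlim_ext_loc (fun x => scal (V := C_R_NormedModule)
           (exp (s * x)) (RtoC (a * s + b) * A)%C)).
  { generalize hGD; apply filter_imp; intros x hx.
    rewrite (robin_exp D a b s A T x hD hT hx), (Cmult_comm _ (RtoC (exp _))).
    apply scal_R_Cmult. }
  refine (filterlim_filter_le_1 _ hG _).
  replace (RtoC (a * s + b) * A)%C
    with (scal (V := C_R_NormedModule) (exp (s * 0)) (RtoC (a * s + b) * A)%C) at 1.
  2:{ rewrite Rmult_0_r, exp_0; apply (scal_one (V := C_R_NormedModule)). }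
  apply (continuous_scal_l (V := C_R_NormedModule) (fun x => exp (s * x))).
  apply (ex_derive_continuous (V := R_NormedModule)); auto_derive; easy.
Qed.

Lemma left_robin_trace (a b s : R) (A g : C) (T : R -> C) :
  (forall y, y < 0 -> T y = (A * RtoC (exp (s * y)))%C) ->
  left_trace (robin a b T) g -> g = (RtoC (a * s + b) * A)%C.
Proof.
  intros hT hg.
  apply (robin_trace (fun y => y < 0) (at_left 0) a b s A g T); auto.
  - apply open_lt.
  - exists (mkposreal 1 Rlt_0_1); auto.
  - apply filter_le_within.
Qed.

Lemma right_robin_trace (a b s : R) (A g : C) (T : R -> C) :
  (forall y, 0 < y -> T y = (A * RtoC (exp (s * y)))%C) ->
  right_trace (robin a b T) g -> g = (RtoC (a * s + b) * A)%C.
Proof.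
  intros hT hg.
  apply (robin_trace (fun y => 0 < y) (at_right 0) a b s A g T); auto.
  - apply open_gt.
  - exists (mkposreal 1 Rlt_0_1); auto.
  - apply filter_le_within.
Qed.

(** * Convergence of the coefficients *)

Lemma Cmult_real_solve (d e : R) (A B : C) :
  0 < d -> (RtoC d * A)%C = (RtoC e * B)%C -> A = (RtoC (e / d) * B)%C.
Proof.
  intros hd h.
  assert (hd' : RtoC d <> RtoC 0) by (intros H; apply RtoC_inj in H; lra).
  rewrite RtoC_div by lra.
  replace (RtoC e / RtoC d * B)%C with (RtoC e * B / RtoC d)%C by (field; exact hd').
  rewrite <- h; field; exact hd'.
Qed.

(** A bound by a geometric sequence whose ratio [s] satisfies [r <= s ^ 2];
    the arithmetic mean [s = (1 + r) / 2] avoids a square root and is positive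
    even when [r = 0]. *)
Lemma two_step_contraction (r : R) (u : nat -> C) :
  Rabs r < 1 ->
  (forall n, (1 <= n)%nat -> u (S (S n)) = (RtoC r * u n)%C) ->
  filterlim u eventually (locally (T := C_UniformSpace) (RtoC 0)).
Proof.
  intros hr hu.
  pose proof (Rabs_pos r) as r0.
  set (s := (1 + Rabs r) / 2).
  assert (hs : 0 < s < 1) by (unfold s; lra).
  assert (hrs : Rabs r <= s ^ 2).
  { pose proof (pow2_ge_0 (1 - Rabs r)); unfold s; nra. }
  set (M := Cmod (u 1%nat) / s + Cmod (u 2%nat) / s ^ 2).
  assert (s2 : 0 < s ^ 2) by (apply pow_lt; lra).
  assert (P1 : 0 <= Cmod (u 1%nat) / s)
    by (apply Rdiv_le_0_compat; [apply Cmod_ge_0|lra]).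
  assert (P2 : 0 <= Cmod (u 2%nat) / s ^ 2)
    by (apply Rdiv_le_0_compat; [apply Cmod_ge_0|lra]).
  assert (hM : forall n, Cmod (u (S n)) <= M * s ^ S n /\
                         Cmod (u (S (S n))) <= M * s ^ S (S n)).
  { induction n as [|n [I1 I2]].
    - split.
      + apply Rle_trans with (Cmod (u 1%nat) / s * s ^ 1).
        * right; field; lra.
        * apply Rmult_le_compat_r; [apply pow_le|unfold M]; lra.
      + apply Rle_trans with (Cmod (u 2%nat) / s ^ 2 * s ^ 2).
        * right; field; lra.
        * apply Rmult_le_compat_r; [|unfold M]; lra.
    - split; [exact I2|].
      rewrite hu by lia; rewrite Cmod_mult, Cmod_R.
      apply Rle_trans with (s ^ 2 * (M * s ^ S n)).
      + apply Rmult_le_compat; [lra|apply Cmod_ge_0|exact hrs|exact I1].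
      + right; simpl; ring. }
  apply (filterlim_norm_zero (V := C_NormedModule)).
  apply (is_lim_seq_incr_1 (fun n => Cmod (u n)) 0).
  apply (is_lim_seq_le_le (fun _ => 0) _ (fun n => M * s ^ S n)).
  - intros n; split; [apply Cmod_ge_0|apply hM].
  - apply is_lim_seq_const.
  - apply (is_lim_seq_incr_1 (fun n => M * s ^ n)).
    replace (Finite 0) with (Rbar_mult M 0) by (simpl; f_equal; ring).
    apply is_lim_seq_scal_l, is_lim_seq_geom.
    rewrite Rabs_pos_eq; lra.
Qed.

Theorem theorem2p3 (Rc kappa1 kappa2 c1 c2 kmin kmax : R)
    (hRc : 0 < Rc) (hkappa1 : 0 < kappa1) (hkappa2 : 0 < kappa2)
    (hc1 : 0 <= c1) (hc2 : 0 <= c2) (hkmin : 0 < kmin) (hk : kmin < kmax)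
    (p : R) (hp0 : 0 < p) (hp : p < 2 / Rc) :
  (forall k : R, kmin <= k <= kmax ->
     Rabs (rho Rc kappa1 kappa2 c1 c2 k p p) =
       Rabs ((1 - p * (Rc + xi kappa2 c2 k)) / (1 + p * xi kappa1 c1 k) *
             ((1 - p * (Rc + xi kappa1 c1 k)) / (1 + p * xi kappa2 c2 k))) /\
     Rabs (rho Rc kappa1 kappa2 c1 c2 k p p) < 1) /\
  (forall (g1 g2 : R -> C) (T1 T2 : nat -> R -> R -> C),
     (forall k : R, kmin <= k <= kmax ->
        OSM_Robin Rc kappa1 kappa2 c1 c2 p k (g1 k) (g2 k)
          (fun n => T1 n k) (fun n => T2 n k)) ->
     exists A1 B2 : nat -> R -> C,
       forall k : R, kmin <= k <= kmax ->
         (forall (n : nat) (x : R), (1 <= n)%nat -> x < 0 ->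
            T1 n k x = (A1 n k * RtoC (exp (lambda kappa1 c1 k * x)))%C) /\
         (forall (n : nat) (x : R), (1 <= n)%nat -> 0 < x ->
            T2 n k x = (B2 n k * RtoC (exp (- lambda kappa2 c2 k * x)))%C) /\
         filterlim (fun n => A1 n k) eventually
           (locally (T := C_UniformSpace) (RtoC 0)) /\
         filterlim (fun n => B2 n k) eventually
           (locally (T := C_UniformSpace) (RtoC 0))).
Proof.
  assert (h2 : p * Rc < 2).
  { apply (Rlt_div_r p) in hp; lra. }
  split.
  { intros k hkk; split.
    - unfold rho; rewrite !Rmult_plus_distr_l, !Rminus_plus_distr; reflexivity.
    - apply Rabs_rho_lt_1; auto; lra. }
  intros g1 g2 T1 T2 H.
  (* Undoing the exponential at one point of each subdomain defines the
     coefficients by a formula, for all frequencies at once and without choice;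
     -1 and 1 are arbitrary such points. *)
  exists (fun n k => (T1 n k (-1) * RtoC (exp (lambda kappa1 c1 k)))%C),
    (fun n k => (T2 n k 1 * RtoC (exp (lambda kappa2 c2 k)))%C).
  intros k hkk; specialize (H k hkk); assert (k0 : 0 < k) by lra.
  set (l1 := lambda kappa1 c1 k); set (l2 := lambda kappa2 c2 k).
  set (A := fun n => (T1 n k (-1) * RtoC (exp l1))%C).
  set (B := fun n => (T2 n k 1 * RtoC (exp l2))%C).
  destruct H as [sol1 sol2 _ _ step1 step2].
  assert (EA : forall n x, (1 <= n)%nat -> x < 0 ->
            T1 n k x = (A n * RtoC (exp (l1 * x)))%C).
  { intros n x hn hx.
    destruct (left_solution_exp kappa1 c1 k (T1 n k)) as [a ha]; auto.
    unfold A; rewrite (ha x hx), (ha (-1)) by lra; fold l1.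
    rewrite <- (Cmult_assoc a), <- RtoC_mult, <- exp_plus.
    replace (l1 * -1 + l1) with 0 by ring; rewrite exp_0; ring. }
  assert (EB : forall n x, (1 <= n)%nat -> 0 < x ->
            T2 n k x = (B n * RtoC (exp (- l2 * x)))%C).
  { intros n x hn hx.
    destruct (right_solution_exp kappa2 c2 k (T2 n k)) as [b hb]; auto.
    unfold B; rewrite (hb x hx), (hb 1) by lra; fold l2.
    rewrite <- (Cmult_assoc b), <- RtoC_mult, <- exp_plus.
    replace (- l2 * 1 + l2) with 0 by ring; rewrite exp_0; ring. }
  split; [exact EA|split; [exact EB|]].
  set (m1 := kappa1 * l1); set (m2 := kappa2 * l2).
  assert (0 < m1) by (apply Rmult_lt_0_compat; [lra|now apply lambda_pos]).
  assert (0 < m2) by (apply Rmult_lt_0_compat; [lra|now apply lambda_pos]).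
  set (q1 := (p - (1 - p * Rc) * m2) / (m1 + p)).
  set (q2 := (p - (1 - p * Rc) * m1) / (m2 + p)).
  assert (hq : q1 * q2 = rho Rc kappa1 kappa2 c1 c2 k p p)
    by now apply step_ratio_product.
  assert (stepA : forall n, (1 <= n)%nat -> A (S n) = (RtoC q1 * B n)%C).
  { intros n hn; apply Cmult_real_solve; [lra|].
    destruct (step1 (S n)) as [g [hl hr]]; [lia|].
    replace (S n - 1)%nat with n in hr by lia.
    apply (left_robin_trace _ _ l1 (A (S n))) in hl; [|intros; apply EA; auto; lia].
    apply (right_robin_trace _ _ (- l2) (B n)) in hr; [|intros; apply EB; auto].
    replace (m1 + p) with (kappa1 * l1 + p) by reflexivity.
    replace (p - (1 - p * Rc) * m2) with ((1 - p * Rc) * kappa2 * - l2 + p)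
      by (unfold m2; ring).
    congruence. }
  assert (stepB : forall n, (1 <= n)%nat -> B (S n) = (RtoC q2 * A n)%C).
  { intros n hn; apply Cmult_real_solve; [lra|].
    destruct (step2 (S n)) as [g [hr hl]]; [lia|].
    replace (S n - 1)%nat with n in hl by lia.
    apply (left_robin_trace _ _ l1 (A n)) in hl; [|intros; apply EA; auto].
    apply (right_robin_trace _ _ (- l2) (B (S n))) in hr;
      [|intros; apply EB; auto; lia].
    replace (m2 + p) with (- kappa2 * - l2 + p) by (unfold m2; ring).
    replace (p - (1 - p * Rc) * m1) with ((-1 + p * Rc) * kappa1 * l1 + p)
      by (unfold m1; ring).
    congruence. }
  assert (hrho : Rabs (q1 * q2) < 1)
    by (rewrite hq; apply Rabs_rho_lt_1; auto; lra).
  split; apply (two_step_contraction (q1 * q2)); auto; intros n hn;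
    rewrite RtoC_mult.
  - rewrite stepA, stepB by lia; ring.
  - rewrite stepB, stepA by lia; ring.
Qed.
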